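(* Let $R$ be a finite commutative chain ring with nilpotency index $s>1$ and let $n\ge1$. Then the symmetrized homogeneous weight-unit partition $\mathcal{P}^{\mathsf{hom}}_{\mathrm{sym},n}$ of $R^n$ is Fourier-reflexive.
   Context: Let $\langle\gamma\rangle$ be the maximal ideal of $R$, $s$ the nilpotency index of $\gamma$, and $\mathcal{S}=\langle\gamma^{s-1}\rangle$ the socle. The homogeneous weight-unit partition of $R$ is $\mathcal{P}^{\mathsf{hom}}=Z\mid U\mid S\mid R_0$ with $Z=\{0\}$, $U=R^\times$, $S=\mathcal{S}\setminus\{0\}$, $R_0=\langle\gamma\rangle\setminus\langle\gamma^{s-1}\rangle$ (empty, and omitted, when $s=2$). Given a partition $\mathcal{P}=P_1\mid\cdots\mid P_m$ of a finite abelian group $G$, the induced symmetrized partition $\mathcal{P}_{\mathrm{sym},n}$ of $G^n$ is given by the equivalence relation $g\sim g'$ iff $|\{i: g_i\in P_j\}|=|\{i: g'_i\in P_j\}|$ for all $j$. Dual partition: for a finite abelian group $G$ with character group $\widehat G$ and a partition $\mathcal{P}=P_1\mid\cdots\mid P_m$ of $G$, $\widehat{\mathcal{P}}$ is the partition of $\widehat G$ in which $\chi,\chi'$ lie in the same block iff $\sum_{x\in P_i}\chi(x)=\sum_{x\in P_i}\chi'(x)$ for all $i$. $\mathcal{P}$ is Fourier-reflexive if $\widehat{\widehat{\mathcal{P}}}=\mathcal{P}$ under the natural identification $\widehat{\widehat G}=G$. Here $G=(R^n,+)$. *)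

(* Defs.v *)
From HB Require Import structures.
From mathcomp Require Import all_boot all_order all_fingroup all_algebra all_solvable all_field.

Set Implicit Arguments.
Unset Strict Implicit.
Unset Printing Implicit Defensive.

Import Order.TTheory GRing.Theory Num.Theory.
Local Open Scope ring_scope.

(** Complex characters of a finite abelian group take roots of unity as values,
    so they are taken with values in [algC]. *)

Section CharacterGroup.

Variable G : finZmodType.

Definition is_char (f : {ffun G -> algC}) : bool :=
  (f 0 == 1) && [forall x, forall y, f (x + y) == f x * f y].

Record char_group : predArgType :=
  Char { char_val :> {ffun G -> algC}; _ : is_char char_val }.

HB.instance Definition _ := [isSub of char_group for char_val].
HB.instance Definition _ := [Choice of char_group by <:].

Lemma char0 (chi : char_group) : chi 0 = 1.
Proof. by case: chi => f /= /andP[/eqP]. Qed.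

Lemma charD (chi : char_group) x y : chi (x + y) = chi x * chi y.
Proof. by case: chi => f /= /andP[_ /forallP/(_ x)/forallP/(_ y)/eqP]. Qed.

Lemma charMn (chi : char_group) x k : chi (x *+ k) = chi x ^+ k.
Proof.
elim: k => [|k IHk]; first by rewrite mulr0n char0 expr0.
by rewrite mulrS charD IHk exprS.
Qed.

Lemma char_neq0 (chi : char_group) x : chi x != 0.
Proof.
apply/eqP => chix0; have := oner_neq0 algC.
by rewrite -(char0 chi) -(subrr x) charD chix0 mul0r eqxx.
Qed.

Lemma is_charI (f : {ffun G -> algC}) :
  f 0 = 1 -> (forall x y, f (x + y) = f x * f y) -> is_char f.
Proof.
move=> f0 fD; rewrite /is_char f0 eqxx /=.
by apply/forallP => x; apply/forallP => y; rewrite fD.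
Qed.

Fact one_is_char : is_char [ffun => 1].
Proof. by apply: is_charI => [|x y]; rewrite !ffunE ?mulr1. Qed.

Fact mul_is_char (chi psi : char_group) : is_char [ffun x => chi x * psi x].
Proof.
by apply: is_charI => [|x y]; rewrite !ffunE ?char0 ?mulr1 // !charD mulrACA.
Qed.

Fact inv_is_char (chi : char_group) : is_char [ffun x => (chi x)^-1].
Proof.
by apply: is_charI => [|x y]; rewrite !ffunE ?char0 ?invr1 // charD invfM.
Qed.

(** The group law is pointwise multiplication of characters; [char_group] is
    made a [finZmodType], so that law is written additively. *)
Definition char_one : char_group := Char one_is_char.
Definition char_mul (chi psi : char_group) : char_group :=
  Char (mul_is_char chi psi).
Definition char_inv (chi : char_group) : char_group := Char (inv_is_char chi).

Fact char_mulA : associative char_mul.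
Proof.
by move=> a b c; apply/val_inj/ffunP => x; rewrite /= !ffunE /= ?ffunE mulrA.
Qed.

Fact char_mulC : commutative char_mul.
Proof. by move=> a b; apply/val_inj/ffunP => x; rewrite /= !ffunE mulrC. Qed.

Fact char_mul1 : left_id char_one char_mul.
Proof.
by move=> a; apply/val_inj/ffunP => x; rewrite /= !ffunE /= ?ffunE mul1r.
Qed.

Fact char_mulV : left_inverse char_one char_inv char_mul.
Proof.
move=> a; apply/val_inj/ffunP => x.
by rewrite /= !ffunE /= ?ffunE mulVf // char_neq0.
Qed.

HB.instance Definition _ :=
  GRing.isZmodule.Build char_group char_mulA char_mulC char_mul1 char_mulV.

Definition unity_roots : seq algC :=
  sval (closed_field_poly_normal ('X^#|G| - 1)).

Fact char_unity_root (chi : char_group) x : chi x \in unity_roots.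
Proof.
rewrite /unity_roots; case: closed_field_poly_normal => r /= defr.
have G_gt0 : (0 < #|G|)%N by apply/card_gt0P; exists x.
have chix1 : chi x ^+ #|G| = 1.
  have := expg_cardG (in_setT x).
  by rewrite cardsT FinRing.zmodXgE -charMn => ->; rewrite char0.
have : root ('X^#|G| - 1) (chi x) by rewrite rootE !hornerE chix1 subrr.
rewrite defr rootZ ?root_prod_XsubC // lead_coef_eq0.
by rewrite -size_poly_eq0 size_XnsubC.
Qed.

Definition char_to_roots (chi : char_group) : {ffun G -> seq_sub unity_roots} :=
  [ffun x => SeqSub (char_unity_root chi x)].

Definition char_of_roots (f : {ffun G -> seq_sub unity_roots}) :
    option char_group := insub [ffun x => val (f x)].

Fact char_to_rootsK : pcancel char_to_roots char_of_roots.
Proof.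
move=> chi; rewrite /char_of_roots -[RHS](valK chi); congr insub.
by apply/ffunP => x; rewrite !ffunE.
Qed.

HB.instance Definition _ := [Countable of char_group by <:].
HB.instance Definition _ : isFinite char_group := PCanIsFinite char_to_rootsK.

End CharacterGroup.

Fact eval_is_char (G : finZmodType) (x : G) :
  is_char [ffun chi : char_group G => chi x].
Proof. by apply: is_charI => [|chi psi]; rewrite !ffunE /= ?ffunE. Qed.

(** The natural map from [G] to its double character group. *)
Definition char_eval (G : finZmodType) (x : G) : char_group (char_group G) :=
  Char (eval_is_char x).

Definition dual_partition (G : finZmodType) (P : {set {set G}}) :
    {set {set char_group G}} :=
  equivalence_partition
    (fun chi psi : char_group G =>
       [forall B in P, \sum_(x in B) chi x == \sum_(x in B) psi x])
    [set: char_group G].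

Definition fourier_reflexive (G : finZmodType) (P : {set {set G}}) : Prop :=
  dual_partition (dual_partition P)
  = [set [set char_eval x | x in B] | B : {set G} in P].

Definition sym_partition (G : finZmodType) (P : {set {set G}}) (n : nat) :
    {set {set 'rV[G]_n}} :=
  equivalence_partition
    (fun g h : 'rV[G]_n =>
       [forall B in P, #|[set i | g 0 i \in B]| == #|[set i | h 0 i \in B]|])
    [set: 'rV[G]_n].

Section ChainRing.

Variable R : finComUnitRingType.
Implicit Type I : {set R}.

Definition is_ideal I : bool :=
  (0 \in I) && [forall a, forall x in I, forall y in I, a * x + y \in I].

Definition chain_ring : Prop :=
  forall I J, is_ideal I -> is_ideal J -> (I \subset J) || (J \subset I).

Definition maximal_ideal I : bool :=
  maxset (fun J : {set R} => is_ideal J && (J != [set: R])) I.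

Definition principal_ideal (a : R) : {set R} := [set x * a | x : R].

Definition nilpotency_index (a : R) (s : nat) : Prop :=
  a ^+ s = 0 /\ forall k, (k < s)%N -> a ^+ k != 0.

(** The set difference drops the last block when it is empty. *)
Definition hom_partition (gamma : R) (s : nat) : {set {set R}} :=
  let socle := principal_ideal (gamma ^+ s.-1) in
  [set [set 0]; [set x | x \is a GRing.unit]; socle :\ 0;
       principal_ideal gamma :\: socle] :\ set0.

End ChainRing.

(* Main.v *)
Require Import Defs.
From mathcomp Require Import all_boot all_order all_fingroup all_algebra.
From mathcomp Require Import all_field all_character.

Set Implicit Arguments.
Unset Strict Implicit.
Unset Printing Implicit Defensive.

Import Order.TTheory GRing.Theory Num.Theory.
Local Open Scope ring_scope.

(** The self-duality of the ring is the core of the argument. Fix a character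
    [chi] of [R] that is nontrivial on the socle generator [gamma ^+ s.-1].
    Every nonzero ideal of a chain ring contains the socle, so [chi] is trivial
    on no nonzero ideal; hence [u |-> chi (u * _)] identifies [R] with its
    character group, and the sum of [chi (u * x)] over an ideal is its order
    when [u] annihilates the ideal and 0 otherwise. Number the terms of the
    filtration of [R] by [R] itself, the maximal ideal, the socle and 0 from 0
    to 3. The annihilator of the [j]-th term is the [(3 - j)]-th
    ([annihilator_maximal], [annihilator_socle]), and the nonempty differences
    of consecutive terms are the blocks of the homogeneous weight-unit
    partition. So the block sums of [chi (u * _)] depend only on the block of
    [u], and they determine it: the partition is its own dual.

    The passage to [R^n] is by generating functions. The pairing on rows is the
    product of the coordinate pairings, so summing it over all rows with
    prescribed blocks in each position gives a product of block sums; summing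
    over the rearrangements of such a prescription shows that the sum over a
    symmetrized block depends only on the symmetrized block of [u]
    ([same_type_sum_eq]). Conversely, weight each entry in a nonzero block by a
    number and the entry 0 by that number plus an indeterminate. The weighted
    sum over all rows is then a product of [n] monic linear polynomials, one for
    each entry of [u], and its roots, taken with multiplicity, count the entries
    of [u] in each block, provided that the weights separate the blocks
    ([sum_eq_same_type]). Along the filtration the weights 1, 2, 3, 4 do, as the
    weighted sum is a sum over the terms of the filtration of quantities that
    can only grow with the level of [u] ([weighted_level_inj]).

    Finally, a partition that is its own dual under a symmetric nondegenerate
    pairing is Fourier-reflexive ([self_dual_fourier_reflexive]); this uses that
    a finite abelian group and its character group have the same order. *)

(** * Pontryagin duality for finite abelian groups *)

Section Orthogonality.

Variable G : finZmodType.
Implicit Types (chi psi : char_group G) (A : {set G}).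

Lemma char_groupP chi psi : chi =1 psi -> chi = psi.
Proof. by move=> e; apply/val_inj/ffunP. Qed.

Lemma sum_char_group chi A :
  {in A &, forall x y, x + y \in A} ->
  \sum_(x in A) chi x = if [forall x in A, chi x == 1] then #|A|%:R else 0.
Proof.
move=> AD; case: ifPn => [/forall_inP chi1 | /forall_inPn[y Ay chiy]].
  by rewrite (eq_bigr (fun=> 1)) => [|x /chi1/eqP]; rewrite // sumr_const.
(* Translation by y permutes A and multiplies the sum by chi y. *)
have eqA : [set x + y | x in A] = A.
  apply/eqP; rewrite eqEcard card_imset ?leqnn ?andbT; last exact: addIr.
  by apply/subsetP=> _ /imsetP[x Ax ->]; apply: AD.
have : \sum_(x in A) chi x = (\sum_(x in A) chi x) * chi y.
  rewrite -{1}eqA big_imset /=; last by move=> ? ? _ _ /addIr.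
  by rewrite big_distrl /=; apply: eq_bigr => x _; rewrite charD.
move/eqP; rewrite -subr_eq0 -{1}[\sum_(_ in _) _]mulr1 -mulrBr mulf_eq0.
by rewrite subr_eq0 (eq_sym 1) (negPf chiy) orbF => /eqP.
Qed.

End Orthogonality.

Section Duality.

Variable G : finZmodType.
Implicit Type chi : char_group G.

(** Irreducible characters of an abelian group are linear, and their kernels
    meet trivially. *)
Lemma char_separates (x : G) : x != 0 -> exists chi, chi x != 1.
Proof.
move=> nzx; pose H : {group G} := [set: G]%G.
have linH := char_abelianP H (FinRing.zmod_abelian _).
have [/existsP[chi nchi]|] := boolP [exists chi : char_group G, chi x != 1].
  by exists chi.
rewrite negb_exists => /forallP chi1; case/negP: nzx.
suff: x \in \bigcap_i cfker 'chi[H]_i by rewrite TI_cfker_irr => /set1gP ->.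
apply/bigcapP => i _; have lin_i := linH i; rewrite cfkerEirr inE.
have chiP : is_char [ffun y : G => 'chi[H]_i y].
  apply: is_charI => [|y z]; rewrite !ffunE; first exact: lin_char1.
  by rewrite -lin_charM ?inE.
have := chi1 (Char chiP); rewrite negbK /= ffunE => /eqP->.
by rewrite lin_char1.
Qed.

(** Both orders of summation of [chi x] over all [x] and [chi] keep only the
    trivial element of one side. *)
Lemma card_char_group : #|char_group G| = #|G|.
Proof.
have sum_x chi :
    \sum_(x in [set: G]) chi x = if chi == 0 then #|G|%:R else 0.
  rewrite sum_char_group ?cardsT; last by move=> ? ? _ _; rewrite inE.
  congr (if _ then _ else _); apply/forall_inP/eqP => [chi1|-> x _].
    by apply: char_groupP => x; rewrite (eqP (chi1 x _)) ?inE //= ffunE.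
  by rewrite /= ffunE.
have sum_chi (x : G) :
    \sum_(chi in [set: char_group G]) (chi : char_group G) x
      = if x == 0 then #|char_group G|%:R else 0.
  transitivity (\sum_(chi in [set: char_group G]) char_eval x chi).
    by apply: eq_bigr => chi _; rewrite /= ffunE.
  rewrite sum_char_group ?cardsT; last by move=> ? ? _ _; rewrite inE.
  congr (if _ then _ else _); apply/forall_inP/eqP => [chi1|-> chi _].
    apply: contraTeq isT => /char_separates[chi]; have := chi1 chi (in_setT _).
    by rewrite /= ffunE => ->.
  by rewrite /= ffunE char0.
have sum_if (T : finZmodType) (c : algC) :
    \sum_(x in [set: T]) (if x == 0 then c else 0) = c.
  by rewrite -big_mkcondr (big_pred1 0) // => x; rewrite inE.
apply/eqP; rewrite -(eqr_nat algC) -[eqbLHS](sum_if G).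
rewrite -(eq_bigr _ (fun x _ => sum_chi x)) exchange_big /=.
by rewrite (eq_bigr _ (fun chi _ => sum_x chi)) sum_if.
Qed.

Lemma char_eval_inj : injective (@char_eval G).
Proof.
move=> x y exy; apply/eqP; rewrite -subr_eq0; apply: contraTT isT.
case/char_separates=> chi; case/eqP.
have := congr1 (fun f : char_group (char_group G) => f chi) exy.
rewrite /= !ffunE => chixy; apply: (mulIf (char_neq0 chi y)).
by rewrite -charD subrK mul1r.
Qed.

End Duality.

(** * Partitions that a symmetric pairing makes self-dual *)

Lemma imset_equivalence_partition (T T' : finType) (f : T -> T')
    (e : rel T) (e' : rel T') :
  bijective f -> (forall x y, e' (f x) (f y) = e x y) ->
  equivalence_partition e' [set: T']
    = [set f @: B | B : {set T} in equivalence_partition e [set: T]].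
Proof.
case=> g fK gK e'f; have finj := can_inj fK.
have imf x : f @: [set y in [set: T] | e x y]
              = [set y in [set: T'] | e' (f x) y].
  apply/setP=> y; rewrite -[y]gK mem_imset // !inE.
  by rewrite e'f.
apply/setP=> C; apply/imsetP/imsetP => [[x' _ ->]|[_ /imsetP[x _ ->] ->]].
  exists [set y in [set: T] | e (g x') y]; last by rewrite imf gK.
  by apply/imsetP; exists (g x').
by exists (f x).
Qed.

(** An injective symmetric pairing identifies [G] with its character group in
    such a way that evaluation at [y] becomes the character paired with [y]. If
    the partition is self-dual for this identification, then passing to the
    double dual repeats the same computation with the two arguments of the
    pairing exchanged. *)
Lemma self_dual_fourier_reflexive (G : finZmodType) (beta : G -> char_group G)
    (e : rel G) (P := equivalence_partition e [set: G]) :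
  injective beta -> (forall x y, beta x y = beta y x) ->
  (forall u v,
     [forall B in P, \sum_(x in B) beta u x == \sum_(x in B) beta v x]
       = e u v) ->
  fourier_reflexive P.
Proof.
move=> beta_inj beta_sym beta_dual.
have beta_bij : bijective beta.
  by apply: inj_card_bij => //; rewrite card_char_group.
have eval_bij : bijective (@char_eval G).
  by apply: inj_card_bij; [apply: char_eval_inj | rewrite !card_char_group].
have dualP : dual_partition P = [set beta @: B | B : {set G} in P].
  exact: imset_equivalence_partition.
rewrite /fourier_reflexive {1}/dual_partition dualP.
apply: imset_equivalence_partition => // y z; rewrite -beta_dual.
have sum_eval (B : {set G}) w :
    \sum_(chi in beta @: B) char_eval w chi = \sum_(x in B) beta w x.
  rewrite big_imset /=; last by move=> ? ? _ _ /beta_inj.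
  by apply: eq_bigr => x _; rewrite ffunE beta_sym.
apply/forall_inP/forall_inP => [eyz B PB|eyz _ /imsetP[B PB ->]].
  by rewrite -!sum_eval eyz // imset_f.
by rewrite !sum_eval eyz.
Qed.

(** * Symmetrized partitions *)

Section Counts.

Variable n : nat.

Lemma perm_eq_mapP (T : eqType) (s t : 'I_n -> T) :
  reflect (exists p : 'S_n, forall i, s i = t (p i))
          (perm_eq (map s (enum 'I_n)) (map t (enum 'I_n))).
Proof.
have -> : map t (enum 'I_n) = [tuple t i | i < n] by [].
apply: (iffP (tuple_permP (s := map s (enum 'I_n)))) => [[p def_s]|[p def_s]];
  exists p.
  move=> i; have := congr1 (fun l => nth (t i) l i) def_s.
  rewrite (nth_map i) ?size_enum_ord // nth_ord_enum => ->.
  by rewrite -tnth_nth !tnth_mktuple.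
by apply: eq_map => i; rewrite tnth_mktuple.
Qed.

Variable I : finType.
Implicit Types s t : {ffun 'I_n -> I}.

Definition same_counts s t : bool :=
  [forall j, #|[set i | s i == j]| == #|[set i | t i == j]|].

Lemma same_countsP s t :
  reflect (exists p : 'S_n, forall i, s i = t (p i)) (same_counts s t).
Proof.
apply: (iffP forallP) => [est|[p est] j]; last first.
  rewrite (_ : [set i | t i == j] = p @: [set i | s i == j]).
    by rewrite card_imset //; apply: perm_inj.
  apply/setP=> i; rewrite -[i](permKV p) mem_imset; last exact: perm_inj.
  by rewrite !inE est.
apply/perm_eq_mapP/allP => j _; move: (est j).
by rewrite !cardsE !cardE !size_filter -!enumT /= !count_map.
Qed.

Lemma same_counts_equiv : equivalence_rel same_counts.
Proof.
move=> s t r; split; first by apply/forallP => j.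
move=> /forallP est; apply: eq_forallb => j.
by rewrite (eqP (est j)).
Qed.

End Counts.

Section Symmetrization.

Variables (G : finZmodType) (beta : G -> char_group G) (n : nat).
Implicit Types u v x : 'rV[G]_n.

Fact row_pairing_is_char u :
  is_char [ffun x : 'rV[G]_n => \prod_i beta (u 0 i) (x 0 i)].
Proof.
apply: is_charI => [|x y]; rewrite !ffunE.
  by rewrite big1 // => i _; rewrite mxE char0.
by rewrite -big_split; apply: eq_bigr => i _; rewrite mxE charD.
Qed.

Definition row_pairing u : char_group 'rV[G]_n := Char (row_pairing_is_char u).

Lemma row_pairing_sym u x :
  (forall a b, beta a b = beta b a) -> row_pairing u x = row_pairing x u.
Proof. by move=> beta_sym; rewrite /= !ffunE; apply: eq_bigr => i _. Qed.

Lemma row_pairing_inj : injective beta -> injective row_pairing.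
Proof.
move=> beta_inj u v euv; apply/rowP => i; apply: beta_inj.
apply: char_groupP => a.
pose x : 'rV[G]_n := \row_k (if k == i then a else 0).
have pair_x w : row_pairing w x = beta (w 0 i) a.
  rewrite /= ffunE (bigD1 i) //= !mxE eqxx big1 ?mulr1 // => k /negPf nki.
  by rewrite mxE nki char0.
by rewrite -!pair_x euv.
Qed.

Variables (I : finType) (lab : G -> I).

Definition row_label x : {ffun 'I_n -> I} := [ffun i => lab (x 0 i)].

Definition same_type : rel 'rV[G]_n :=
  fun u v => same_counts (row_label u) (row_label v).

Lemma sym_partition_label :
  sym_partition ([set [set a | lab a == j] | j : I] :\ set0) n
    = equivalence_partition same_type [set: 'rV[G]_n].
Proof.
apply: eq_imset => u; apply/setP=> v; rewrite !inE.
have cnt (w : 'rV[G]_n) j : [set i | w 0 i \in [set a | lab a == j]]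
                = [set i | row_label w i == j].
  by apply/setP=> i; rewrite !inE ffunE.
apply/forall_inP/forallP => [euv j | euv B].
  (* A label that is not taken has count 0 in both rows, so dropping the empty
     block loses nothing. *)
  have [e0|nz] := eqVneq [set a | lab a == j] set0; last first.
    by rewrite -!cnt; apply: euv; rewrite !inE nz imset_f.
  by rewrite -!cnt e0 !(eq_card0 (A := [set i | _])) // => i; rewrite !inE.
by rewrite !inE => /andP[_ /imsetP[j _ ->]]; rewrite !cnt.
Qed.

Lemma sum_row (V : nmodType) (F : {ffun 'I_n -> G} -> V) :
  \sum_(f : {ffun 'I_n -> G}) F f = \sum_(x : 'rV[G]_n) F [ffun i => x 0 i].
Proof.
rewrite (reindex (fun x : 'rV[G]_n => [ffun i => x 0 i])) //=.
exists (fun f : {ffun _} => \row_i f i) => [x|f] _.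
  by apply/rowP => i; rewrite mxE ffunE.
by apply/ffunP => i; rewrite !ffunE mxE.
Qed.

(** The rows with prescribed labels form a product of label classes, over which
    the product pairing can be summed one coordinate at a time. *)
Lemma sum_row_label u (t : {ffun 'I_n -> I}) :
  \sum_(x | row_label x == t) row_pairing u x
    = \prod_i \sum_(a | lab a == t i) beta (u 0 i) a.
Proof.
rewrite (bigA_distr_big_dep _ (fun i a => beta (u 0 i) a)) /=.
rewrite big_mkcond [RHS]big_mkcond sum_row /=; apply: eq_bigr => x _.
have -> : (row_label x == t)
           = ([ffun i => x 0 i] \in family (fun i a => lab a == t i)).
  apply/eqP/familyP => [<- i|xt]; first by rewrite !ffunE unfold_in.
  by apply/ffunP => i; have := xt i; rewrite !ffunE unfold_in => /eqP.
case: ifP => // _; rewrite ffunE.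
by apply: eq_bigr => i _; rewrite ffunE.
Qed.

Let P := equivalence_partition same_type [set: 'rV[G]_n].

Hypothesis lab_dual : forall a b j, lab a = lab b ->
  \sum_(x | lab x == j) beta a x = \sum_(x | lab x == j) beta b x.

(** Cut the block [B] into the sets of rows with a given label vector. On each
    of them the sum is a product in which the entries of [u] matter only through
    their labels, and a permutation of the entries of [u] merely permutes the
    label vectors that occur in [B]. *)
Lemma same_type_sum_eq u v (B : {set 'rV[G]_n}) : same_type u v -> B \in P ->
  \sum_(x in B) row_pairing u x = \sum_(x in B) row_pairing v x.
Proof.
move=> /same_countsP[p euv] /imsetP[y _ ->].
have sumB w : \sum_(x in [set x in [set: 'rV[G]_n] | same_type y x])
                 row_pairing w x
    = \sum_(t | same_counts (row_label y) t)
         \prod_i \sum_(a | lab a == t i) beta (w 0 i) a.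
  rewrite (partition_big row_label (same_counts (row_label y))) => [|x] /=.
    apply: eq_bigr => t yt; rewrite -sum_row_label; apply: eq_bigl => x.
    rewrite !inE /same_type.
    by case: eqP => [->|]; rewrite ?yt ?andbF.
  by rewrite !inE.
rewrite !sumB (reindex (fun t : {ffun 'I_n -> I} => [ffun i => t (p i)])) /=.
  apply: eq_big => [t|t _].
    (* Permuting the positions does not change the counts. *)
    apply/idP/idP => /same_countsP[r yr]; apply/same_countsP.
      by exists (r * p)%g => i; rewrite yr ffunE permM.
    by exists (r * p^-1)%g => i; rewrite yr ffunE permM permKV.
  rewrite [RHS](reindex_inj (@perm_inj _ p)) /=; apply: eq_bigr => i _.
  by rewrite ffunE; apply: lab_dual; have := euv i; rewrite !ffunE.
exists (fun t : {ffun _} => [ffun i => t (p^-1 i)%g]) => t _; apply/ffunP => i;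
  by rewrite !ffunE ?permKV ?permK.
Qed.

Hypothesis lab0 : forall a, lab a = lab 0 -> a = 0.

Variable w : I -> algC.
Let wt a := \sum_x w (lab x) * beta a x.
Hypothesis wt_inj : forall a b, wt a = wt b -> lab a = lab b.

(** The indeterminate at the label of 0 keeps the contributions of the single
    coordinates apart: each becomes a monic linear factor with its own root. *)
Let f j : {poly algC} := (w j)%:P + (if j == lab 0 then 'X else 0).

Lemma sum_weighted_pairing u :
  \sum_x (\prod_i f (row_label x i)) * (row_pairing u x)%:P
    = \prod_i ('X - (- wt (u 0 i))%:P).
Proof.
transitivity (\prod_i \sum_a f (lab a) * (beta (u 0 i) a)%:P).
  rewrite bigA_distr_bigA sum_row; apply: eq_bigr => x _.
  rewrite ffunE rmorph_prod -big_split /=.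
  by apply: eq_bigr => i _; rewrite !ffunE.
apply: eq_bigr => i _; rewrite polyCN opprK addrC.
under eq_bigr do rewrite mulrDl; rewrite big_split /=; congr (_ + _).
  by rewrite rmorph_sum; apply: eq_bigr => a _; rewrite rmorphM.
rewrite (bigD1 0) //= eqxx char0 mulr1 big1 ?addr0 // => a nza.
case: eqP => [/lab0 a0|]; last by rewrite mul0r.
by rewrite a0 eqxx in nza.
Qed.

(** The weight of a row depends only on its type, so equal block sums for [u]
    and [v] give equal weighted sums, that is two equal products of monic linear
    polynomials. Their roots agree up to a permutation, and [wt_inj] turns roots
    back into labels. *)
Lemma sum_eq_same_type u v :
  (forall B, B \in P -> \sum_(x in B) row_pairing u x
                         = \sum_(x in B) row_pairing v x) ->
  same_type u v.
Proof.
move=> euv.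
have partP : partition P [set: 'rV[G]_n].
  by apply: equivalence_partitionP => x y z _ _ _; apply: same_counts_equiv.
(* Blocks are nonempty, so the default row 0 never serves as representative. *)
have sumP z : \sum_x (\prod_i f (row_label x i)) * (row_pairing z x)%:P
   = \sum_(B in P) (\prod_i f (row_label (odflt 0 [pick y in B]) i))
        * (\sum_(x in B) row_pairing z x)%:P.
  transitivity (\sum_(x in [set: 'rV[G]_n])
      (\prod_i f (row_label x i)) * (row_pairing z x)%:P).
    by apply: eq_bigl => x; rewrite inE.
  rewrite (set_partition_big _ partP) /=; apply: eq_bigr => B PB.
  rewrite rmorph_sum big_distrr /=; apply: eq_bigr => x Bx; congr (_ * _).
  case: pickP => [y By /=|/(_ x)]; last by rewrite Bx.
  case/imsetP: PB Bx By => c _ ->; rewrite !inE /= /same_type => cx.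
  rewrite ((same_counts_equiv _ _ (row_label y)).2 cx).
  case/same_countsP=> p exy.
  rewrite [RHS](reindex_inj (@perm_inj _ p)) /=.
  by apply: eq_bigr => i _; rewrite exy.
have : \prod_i ('X - (- wt (u 0 i))%:P) = \prod_i ('X - (- wt (v 0 i))%:P).
  rewrite -!sum_weighted_pairing !sumP; apply: eq_bigr => B PB.
  by rewrite euv.
have mapE z : \prod_i ('X - (- wt (z 0 i))%:P)
    = \prod_(c <- [seq - wt (z 0 i) | i <- enum 'I_n]) ('X - c%:P).
  by rewrite big_map big_enum.
rewrite !mapE => /prod_XsubC_eq /perm_eq_mapP[p ep].
apply/same_countsP; exists p => i; rewrite !ffunE.
by apply: wt_inj; apply: oppr_inj; apply: ep.
Qed.

End Symmetrization.

(** The two assumptions on sums say that the partition into label classes is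
    self-dual: [beta a] has block sums that depend only on the label of [a] (the
    fourth premise) and determine it (the fifth, where one weighted combination
    of the block sums already does so). *)
Theorem sym_fourier_reflexive (G : finZmodType) (beta : G -> char_group G)
    (I : finType) (lab : G -> I) (w : I -> algC) (n : nat) :
  injective beta -> (forall a b, beta a b = beta b a) ->
  (forall a, lab a = lab 0 -> a = 0) ->
  (forall a b j, lab a = lab b ->
     \sum_(x | lab x == j) beta a x = \sum_(x | lab x == j) beta b x) ->
  (forall a b, \sum_x w (lab x) * beta a x = \sum_x w (lab x) * beta b x ->
     lab a = lab b) ->
  fourier_reflexive
    (sym_partition ([set [set a | lab a == j] | j : I] :\ set0) n).
Proof.
move=> beta_inj beta_sym lab0 lab_dual wt_inj; rewrite sym_partition_label.
apply: (@self_dual_fourier_reflexive _ (@row_pairing _ beta n)) => [|u x|u v].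
- exact: row_pairing_inj.
- exact: row_pairing_sym.
apply/forall_inP/idP => [euv|/same_type_sum_eq euv B PB].
  apply: (@sum_eq_same_type G beta n I lab lab0 w wt_inj) => B PB.
  exact/eqP/euv.
by rewrite euv.
Qed.

(** * Partitions by a self-dual filtration *)

Section Filtration.

Variables (G : finZmodType) (beta : G -> char_group G).
Variables (k : nat) (lev : G -> 'I_k.+1).

Let A j := [set x | (j <= lev x)%N].

Hypothesis lev_max : forall x, (lev x == k :> nat) = (x == 0).
(** Orthogonality when the terms are subgroups and [A (k - j)] is the
    annihilator of [A j] for the pairing. *)
Hypothesis sum_filtration : forall u j, (j <= k)%N ->
  \sum_(x in A j) beta u x = if (k - j <= lev u)%N then #|A j|%:R else 0.

Lemma sum_level u (j : 'I_k.+1) :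
  \sum_(x | lev x == j) beta u x
    = \sum_(x in A j) beta u x - \sum_(x in A j.+1) beta u x.
Proof.
apply/eqP; rewrite eq_sym subr_eq; apply/eqP.
rewrite (bigID (fun x => lev x == j)) /=; congr (_ + _); apply: eq_bigl => x.
  by rewrite inE -val_eqE /=; case: eqP => [->|]; rewrite ?leqnn ?andbF.
by rewrite !inE -val_eqE /= andbC eq_sym -ltn_neqAle.
Qed.

Lemma sum_level_eq u v j : lev u = lev v ->
  \sum_(x | lev x == j) beta u x = \sum_(x | lev x == j) beta v x.
Proof.
move=> euv; rewrite !sum_level.
have eqA i : \sum_(x in A i) beta u x = \sum_(x in A i) beta v x.
  have [ik|ki] := leqP i k.
    by rewrite (sum_filtration u ik) (sum_filtration v ik) euv.
  by rewrite !big_pred0 // => x; rewrite inE leqNgt (leq_trans (ltn_ord _) ki).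
by rewrite !eqA.
Qed.

(** The weight [(lev x).+1] counts the terms of the filtration that contain
    [x], so the weighted sum is the sum over all terms. *)
Lemma sum_weighted_level u :
  \sum_x (lev x).+1%:R * beta u x
    = \sum_(j < k.+1) if (k - j <= lev u)%N then #|A j|%:R else 0.
Proof.
transitivity (\sum_(j < k.+1) \sum_(x in A j) beta u x).
  rewrite (exchange_big_dep predT) //=; apply: eq_bigr => x _.
  rewrite (eq_bigl (fun j : 'I_k.+1 => (j < (lev x).+1)%N)) => [|j].
    rewrite -(big_ord_widen _ (fun=> beta u x) (ltn_ord _)).
    by rewrite sumr_const card_ord mulr_natl.
  by rewrite inE.
by apply: eq_bigr => j _; apply: sum_filtration; rewrite -ltnS.
Qed.

(** If [lev u < lev v], then the terms present on the right-hand side of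
    [sum_weighted_level] for [u] are present for [v] as well, and the term of
    index [k - lev v], which is positive, is present only for [v]. *)
Lemma weighted_level_inj u v :
  \sum_x (lev x).+1%:R * beta u x = \sum_x (lev x).+1%:R * beta v x ->
  lev u = lev v.
Proof.
rewrite !sum_weighted_level => euv; apply/eqP; apply: contra_eqT euv.
wlog: u v / (lev u < lev v)%N => [wl|luv _].
  rewrite -val_eqE neq_ltn => /orP[luv|lvu].
    by rewrite wl // -val_eqE ltn_eqF.
  by rewrite eq_sym wl // -val_eqE ltn_eqF.
rewrite lt_eqF //.
have lvk : (k - lev v < k.+1)%N by rewrite ltnS leq_subr.
rewrite (bigD1 (Ordinal lvk)) //= [ltRHS](bigD1 (Ordinal lvk)) //=.
have lvk' : (lev v <= k)%N by rewrite -ltnS.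
rewrite (subKn lvk') leqnn leqNgt luv /=; apply: ltr_leD.
  rewrite ltr0n; apply/card_gt0P; exists 0; rewrite inE.
  by have := lev_max 0; rewrite eqxx => /eqP ->; apply: leq_subr.
apply: ler_sum => j _; case: ifP => [lu|_]; last by case: ifP.
by rewrite (leq_trans lu (ltnW luv)).
Qed.

Theorem filtration_sym_fourier_reflexive n :
  injective beta -> (forall x y, beta x y = beta y x) ->
  fourier_reflexive
    (sym_partition ([set [set x | lev x == j] | j : 'I_k.+1] :\ set0) n).
Proof.
move=> beta_inj beta_sym.
apply: (@sym_fourier_reflexive _ beta _ lev (fun j => j.+1%:R)) => //.
- by move=> x ex; apply/eqP; rewrite -lev_max ex lev_max.
- exact: sum_level_eq.
exact: weighted_level_inj.
Qed.

End Filtration.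

(** * Finite chain rings *)

Section ChainRing.

Variable R : finComUnitRingType.

Lemma mem_principalP (a x : R) :
  reflect (exists b, x = b * a) (x \in principal_ideal a).
Proof.
by apply: (iffP imsetP) => [[b _ ->]|[b ->]]; exists b.
Qed.

Lemma principal_add (a : R) :
  {in principal_ideal a &, forall x y, x + y \in principal_ideal a}.
Proof.
move=> _ _ /mem_principalP[b ->] /mem_principalP[c ->].
by apply/mem_principalP; exists (b + c); rewrite mulrDl.
Qed.

Lemma principal_mulr (a x z : R) :
  x \in principal_ideal a -> x * z \in principal_ideal a.
Proof.
move=> /mem_principalP[b ->].
by apply/mem_principalP; exists (b * z); rewrite mulrAC.
Qed.

Lemma principal_is_ideal (a : R) : is_ideal (principal_ideal a).
Proof.
apply/andP; split; first by apply/mem_principalP; exists 0; rewrite mul0r.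
apply/forallP => c; apply/forall_inP => _ /mem_principalP[x ->].
apply/forall_inP => _ /mem_principalP[y ->].
by apply/mem_principalP; exists (c * x + y); rewrite mulrDl mulrA.
Qed.

Variables (gamma : R) (s : nat).
Hypotheses (chainR : chain_ring R)
  (max_gamma : maximal_ideal (principal_ideal gamma))
  (nil_gamma : nilpotency_index gamma s) (s_gt1 : (1 < s)%N).

Let m := principal_ideal gamma.
Let soc := principal_ideal (gamma ^+ s.-1).

Let gamma_s : gamma ^+ s = 0. Proof. by case: nil_gamma. Qed.

Lemma gamma_expr_eq0 k : (gamma ^+ k == 0) = (s <= k)%N.
Proof.
have [sk|ks] := leqP s k; last by apply/negbTE; case: nil_gamma => _ ->.
by rewrite -(subnKC sk) exprD gamma_s mul0r eqxx.
Qed.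

(** In a chain ring the ideal of a nonunit is comparable with the maximal ideal,
    hence contained in it. *)
Lemma mem_maximal_ideal x : (x \in m) = (x \isn't a GRing.unit).
Proof.
have [/andP[_ m_proper] m_max] := maxsetP max_gamma.
apply/idP/idP => [mx|nux].
  apply: contra m_proper => ux; apply/eqP/setP => y; rewrite inE.
  have [b def_x] := mem_principalP _ _ mx.
  apply/mem_principalP; exists (y / x * b).
  by rewrite -(mulrA (y / x)) -def_x mulrVK.
have x_x : x \in principal_ideal x.
  by apply/mem_principalP; exists 1; rewrite mul1r.
have [/subsetP|m_x] := orP (chainR (principal_is_ideal x)
                                     (principal_is_ideal gamma)); first exact.
rewrite /m -(m_max _ _ m_x) // principal_is_ideal /=.
apply: contra nux => /eqP eqT; have := in_setT (1 : R).
rewrite -eqT => /mem_principalP[b def1]; apply/unitrPr; exists b.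
by rewrite mulrC -def1.
Qed.

(** Take the largest [k] with [x] in the ideal of [gamma ^+ k]; if the cofactor
    were a nonunit, it would contribute one more factor [gamma]. *)
Lemma unit_mul_gamma x : x != 0 ->
  exists a k, [/\ a \is a GRing.unit, (k < s)%N & x = a * gamma ^+ k].
Proof.
move=> nzx; pose D k := x \in principal_ideal (gamma ^+ k).
have D_lt k : D k -> (k < s)%N.
  move/mem_principalP=> [b def_x]; rewrite ltnNge -gamma_expr_eq0.
  by apply: contra nzx => /eqP gk0; rewrite def_x gk0 mulr0.
have exD : exists k, D k.
  by exists 0%N; apply/mem_principalP; exists x; rewrite mulr1.
have [k Dk max_k] := ex_maxnP exD (fun k Dk => ltnW (D_lt k Dk)).
have [a def_x] := mem_principalP _ _ Dk; exists a, k; split=> //; last first.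
  exact: D_lt.
have: ~~ D k.+1 by apply/negP=> /max_k; rewrite ltnn.
apply: contraR; rewrite -mem_maximal_ideal => /mem_principalP[b def_a].
by apply/mem_principalP; exists b; rewrite def_x def_a exprS mulrA.
Qed.

Lemma annihilator_socle u :
  (u * gamma ^+ s.-1 == 0) = (u \in m).
Proof.
rewrite mem_maximal_ideal; apply/idP/idP => [u0|].
  apply: contraL u0 => uu.
  rewrite -(mulr0 u) (inj_eq (mulrI uu)) gamma_expr_eq0 -ltnNge.
  by rewrite ltn_predL ltnW.
rewrite -mem_maximal_ideal => /mem_principalP[b ->].
by rewrite -mulrA -exprS prednK ?gamma_s ?mulr0 // ltnW.
Qed.

Lemma annihilator_maximal u : (u * gamma == 0) = (u \in soc).
Proof.
apply/idP/idP => [|/mem_principalP[b ->]]; last first.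
  by rewrite -mulrA -exprSr prednK ?gamma_s ?mulr0 // ltnW.
have [->|/unit_mul_gamma[a [k [ua ks ->]]]] := eqVneq u 0.
  by move=> _; apply/mem_principalP; exists 0; rewrite mul0r.
rewrite -mulrA -exprSr -(mulr0 a) (inj_eq (mulrI ua)) gamma_expr_eq0 => sk.
apply/mem_principalP; exists a; congr (a * gamma ^+ _).
apply: succn_inj; rewrite prednK ?(ltnW s_gt1) //.
by apply/eqP; rewrite eqn_leq ks.
Qed.

(** Every nonzero ideal contains the socle: multiply by the inverse of the unit
    part and by the missing power of [gamma]. *)
Lemma socle_multiple u : u != 0 -> exists z, u * z = gamma ^+ s.-1.
Proof.
case/unit_mul_gamma=> a [k [ua ks ->]]; exists (gamma ^+ (s.-1 - k) / a).
rewrite [_ / a]mulrC mulrACA mulrV // mul1r -exprD subnKC //.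
by rewrite -ltnS prednK // ltnW.
Qed.

(** The largest index of a term containing [x] in the filtration of [R] by [R],
    [m], [soc] and 0, with indices from 0 to 3. For [s = 2] the ideals [m] and
    [soc] coincide and the level 1 does not occur. *)
Definition ideal_level (x : R) : 'I_4 :=
  if x == 0 then inord 3 else if x \in soc then inord 2
  else if x \in m then inord 1 else inord 0.

Lemma socle_sub_maximal : {subset soc <= m}.
Proof.
move=> _ /mem_principalP[b ->]; apply/mem_principalP.
exists (b * gamma ^+ s.-2); rewrite -mulrA -exprSr.
by congr (b * gamma ^+ _); case: s s_gt1 => [|[]].
Qed.

Lemma zero_in_socle : 0 \in soc.
Proof. by apply/mem_principalP; exists 0; rewrite mul0r. Qed.

Lemma leq_ideal_level j x :
  (j <= ideal_level x)%N =
  match j with 0 => true | 1 => x \in m | 2 => x \in soc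
          | 3 => x == 0 | _ => false end.
Proof.
rewrite /ideal_level.
have [->|nzx] := eqVneq x 0.
  rewrite inordK // zero_in_socle (socle_sub_maximal zero_in_socle).
  by case: j => [|[|[|[|]]]].
have [xs|xs] := boolP (x \in soc).
  by rewrite inordK // (socle_sub_maximal xs); case: j => [|[|[|[|]]]].
by case: ifP => mx; rewrite inordK //; case: j => [|[|[|[|]]]].
Qed.

Lemma hom_partition_level :
  hom_partition gamma s =
    [set [set x | ideal_level x == j] | j : 'I_4] :\ set0.
Proof.
have levE (x : R) (j : 'I_4) :
    (ideal_level x == j) = (j <= ideal_level x)%N && ~~ (j < ideal_level x)%N.
  by rewrite -leqNgt -eqn_leq eq_sym.
have lev0 : [set x | ideal_level x == inord 0] = [set x | x \is a GRing.unit].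
  apply/setP=> x; rewrite !inE levE !inordK // !leq_ideal_level.
  by rewrite mem_maximal_ideal negbK.
have lev1 : [set x | ideal_level x == inord 1] = m :\: soc.
  by apply/setP=> x; rewrite !inE levE !inordK // !leq_ideal_level andbC.
have lev2 : [set x | ideal_level x == inord 2] = soc :\ 0.
  by apply/setP=> x; rewrite !inE levE !inordK // !leq_ideal_level andbC.
have lev3 : [set x | ideal_level x == inord 3] = [set 0].
  by apply/setP=> x; rewrite !inE levE !inordK // !leq_ideal_level andbT.
rewrite /hom_partition -/m -/soc -lev0 -lev1 -lev2 -lev3; congr (_ :\ _).
apply/setP=> B; rewrite !inE; apply/idP/imsetP => [|[j _ ->]].
  rewrite -!orbA.
  by case/or4P=> /eqP->;
     [exists (inord 3)|exists (inord 0)|exists (inord 2)|exists (inord 1)].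
rewrite -(inord_val j); case: (val j) (ltn_ord j) => [|[|[|[|]]]] // _;
  by rewrite eqxx ?orbT.
Qed.

Variable chi : char_group R.
Hypothesis chi_socle : chi (gamma ^+ s.-1) != 1.

Fact mul_pairing_is_char (u : R) : is_char [ffun x => chi (u * x)].
Proof.
by apply: is_charI => [|x y]; rewrite !ffunE ?mulr0 ?char0 // mulrDr charD.
Qed.

Definition mul_pairing u : char_group R := Char (mul_pairing_is_char u).

Lemma mul_pairing_sym u x : mul_pairing u x = mul_pairing x u.
Proof. by rewrite /= !ffunE mulrC. Qed.

Lemma mul_pairing_inj : injective mul_pairing.
Proof.
move=> u v euv; apply/eqP; rewrite -subr_eq0; apply: contraTT isT.
case/socle_multiple=> z uvz; have := congr1 (fun f : char_group R => f z) euv.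
rewrite /= !ffunE => chiz; case/eqP: chi_socle.
apply: (mulIf (char_neq0 chi (v * z))).
by rewrite -charD -uvz -mulrDl subrK mul1r.
Qed.

(** The sum is the order of the ideal if [chi] is trivial on [u] times the
    ideal, and 0 otherwise. As [chi] is nontrivial on every nonzero ideal, the first
    case means that [u] annihilates the ideal, and taking annihilators reverses
    the filtration. *)
Lemma sum_mul_pairing u j : (j <= 3)%N ->
  \sum_(x in [set x | (j <= ideal_level x)%N]) mul_pairing u x
    = if (3 - j <= ideal_level u)%N
      then #|[set x | (j <= ideal_level x)%N]|%:R else 0.
Proof.
move=> j3; rewrite sum_char_group; last first.
  move=> x y; rewrite !inE !leq_ideal_level.
  case: j j3 => [|[|[|[|]]]] //=; try by move=> _; apply: principal_add.
  by move=> _ /eqP-> /eqP->; rewrite addr0.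
congr (if _ then _ else _).
transitivity [forall x in [set x | (j <= ideal_level x)%N], u * x == 0].
  apply/forall_inP/forall_inP => [chi1 x Ax|u0 x Ax]; last first.
    by rewrite /= ffunE (eqP (u0 x Ax)) char0.
  apply: contraTT isT => /socle_multiple[z uxz].
  have: x * z \in [set x | (j <= ideal_level x)%N].
    move: Ax; rewrite !inE !leq_ideal_level.
    case: j j3 {chi1} => [|[|[|[|]]]] //=;
      try by move=> _; apply: principal_mulr.
    by move=> _ /eqP->; rewrite mul0r.
  by move/chi1; rewrite /= ffunE mulrA uxz (negPf chi_socle).
have annP a : [forall x in principal_ideal a, u * x == 0] = (u * a == 0).
  apply/forall_inP/eqP => [ua|ua _ /mem_principalP[b ->]].
    by apply/eqP; apply: ua; apply/mem_principalP; exists 1; rewrite mul1r.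
  by rewrite mulrCA ua mulr0.
rewrite leq_ideal_level.
case: j j3 => [|[|[|[|]]]] //= _.
- apply/forall_inP/eqP => [u0|-> x _]; last by rewrite mul0r.
  by apply/eqP; rewrite -[u]mulr1 u0 // inE.
- rewrite -annihilator_maximal -annP; apply: eq_forallb => x.
  by rewrite inE leq_ideal_level.
- rewrite -annihilator_socle -annP; apply: eq_forallb => x.
  by rewrite inE leq_ideal_level.
by apply/forall_inP => x; rewrite inE leq_ideal_level => /eqP->; rewrite mulr0.
Qed.

End ChainRing.

Theorem proposition27 (R : finComUnitRingType) (gamma : R) (s n : nat)
    (chainR : chain_ring R)
    (max_gamma : maximal_ideal (principal_ideal gamma))
    (nil_gamma : nilpotency_index gamma s)
    (s_gt1 : (1 < s)%N) (n_gt0 : (0 < n)%N) :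
  fourier_reflexive (sym_partition (hom_partition gamma s) n).
Proof.
have [chi chi_socle] : exists chi : char_group R, chi (gamma ^+ s.-1) != 1.
  apply: char_separates; case: nil_gamma => _; apply.
  by rewrite ltn_predL ltnW.
rewrite (hom_partition_level chainR max_gamma s_gt1).
apply: (filtration_sym_fourier_reflexive (beta := mul_pairing chi)).
- by move=> x; rewrite eqn_leq -ltnS ltn_ord leq_ideal_level.
- by move=> u j; apply: sum_mul_pairing.
- exact: (mul_pairing_inj chainR max_gamma nil_gamma s_gt1 chi_socle).
by move=> x y; apply: mul_pairing_sym.
Qed.
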